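(* Let $p$ be a prime, $q=p^m$ and $n$ positive integers. Let $\phi(x)=\sum_i a_i x^{q^i}$ with all $a_i\in\mathbb{F}_q$ (an $\mathbb{F}_q$-linear polynomial over $\mathbb{F}_q$), viewed as an endomorphism of $\mathbb{F}_{q^n}$, let $g\in\mathbb{F}_{q^n}[x]$ and $b\in\mathbb{F}_q^*$. Put $$f_1(x)=b\phi(x)+\mathrm{Tr}_q^{q^n}\big(g(x^q-x)\big),\qquad f_2(x)=b\phi(x)+g(x^q-x)^{(q^n-1)/(q-1)}.$$ If $f_1$ (respectively $f_2$) is a permutation polynomial of $\mathbb{F}_{q^n}$, then $f_1$ (respectively $f_2$) is PcN over $\mathbb{F}_{q^n}$ for every $c\in\mathbb{F}_q\setminus\{1\}$.
   Context: $\mathrm{Tr}_q^{q^n}(y)=\sum_{i=0}^{n-1}y^{q^i}$ is the relative trace. For $f:\mathbb{F}_{Q}\to\mathbb{F}_{Q}$ and $c\in\mathbb{F}_Q$, ${}_c\Delta_f(a,b)=\#\{x\in\mathbb{F}_Q: f(x+a)-cf(x)=b\}$ and ${}_c\Delta_f=\max\{{}_c\Delta_f(a,b): a,b\in\mathbb{F}_Q,\ (a,c)\neq(0,1)\}$; $f$ is PcN if ${}_c\Delta_f\le 1$. *)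

(* Defs.v *)
From mathcomp Require Import all_boot all_order all_algebra.

Set Implicit Arguments.
Unset Strict Implicit.
Unset Printing Implicit Defensive.

Import GRing.Theory.
Local Open Scope ring_scope.

(* The field F_Q is an arbitrary [L : finFieldType], and its subfield F_q is
   given by a field [F : finFieldType] of order q together with an embedding
   [iota : {rmorphism F -> L}]. *)

(* Stated over any ring, so that it applies both to field elements and, as the
   polynomial expression Tr(h(x)), to polynomials. *)
Definition relTrace (R : nzRingType) (q n : nat) (y : R) : R :=
  \sum_(i < n) y ^+ (q ^ i).

Definition linearized_poly (F : nzRingType) (q k : nat) (a : 'I_k -> F) : {poly F} :=
  \sum_(i < k) a i *: 'X^(q ^ i).

Definition cDelta (L : finFieldType) (f : L -> L) (c a b : L) : nat :=
  #|[set x : L | f (x + a) - c * f x == b]|.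

Definition cDelta_max (L : finFieldType) (f : L -> L) (c : L) : nat :=
  \max_(ab : L * L | (ab.1, c) != (0, 1)) cDelta f c ab.1 ab.2.

Definition PcN (L : finFieldType) (f : {poly L}) (c : L) : Prop :=
  (cDelta_max (horner f) c <= 1)%N.

Definition permutation_poly (L : finFieldType) (f : {poly L}) : Prop :=
  bijective (horner f).

Definition f1 (F L : finFieldType) (iota : {rmorphism F -> L}) (q n : nat)
    (phi : {poly F}) (g : {poly L}) (b : F) : {poly L} :=
  iota b *: map_poly iota phi + relTrace q n (g \Po ('X^q - 'X)).

Definition f2 (F L : finFieldType) (iota : {rmorphism F -> L}) (q n : nat)
    (phi : {poly F}) (g : {poly L}) (b : F) : {poly L} :=
  iota b *: map_poly iota phi
  + (g \Po ('X^q - 'X)) ^+ ((q ^ n - 1) %/ (q - 1)).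

(* Main.v *)
Require Import Defs.
From mathcomp Require Import all_boot all_order all_algebra all_field.

Import GRing.Theory.
Local Open Scope ring_scope.

(** Put [psi x = x^q - x]. Both polynomials have the form
    [f x = ell x + h (psi x)], where [ell] is F_q-linear and commutes with [psi]
    and [h] takes values fixed by the q-Frobenius, so that
    [psi \o f = ell \o psi]. As [f] is onto, [ell] maps the image of [psi] onto
    itself, hence is injective on it. If [f (x + a) - c f x = f (y + a) - c f y],
    applying [psi] gives [ell (psi x) = ell (psi y)], so [psi x = psi y]; the
    [h] terms then cancel, [ell x = ell y], and [f x = f y]. *)

Lemma linearized_poly_map_horner (F L : finFieldType) (iota : {rmorphism F -> L})
    (q k : nat) (a : 'I_k -> F) (x : L) :
  (map_poly iota (linearized_poly q a)).[x] =
  \sum_(i < k) iota (a i) * x ^+ (q ^ i).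
Proof.
rewrite /linearized_poly rmorph_sum horner_sum; apply: eq_bigr => i _ /=.
by rewrite linearZ /= map_polyXn hornerZ hornerXn.
Qed.

Section FrobeniusFixed.

Variables (L : finFieldType) (q n : nat).
Hypotheses (q_pchar : [pchar L].-nat q) (card_L : #|L| = (q ^ n)%N).

Lemma expf_pcharB (i : nat) (x y : L) :
  (x - y) ^+ (q ^ i) = x ^+ (q ^ i) - y ^+ (q ^ i).
Proof.
have qi_pchar : [pchar L].-nat (q ^ i)%N by rewrite pnatX q_pchar.
apply/eqP; rewrite eq_sym subr_eq.
by rewrite -exprDn_pchar // subrK.
Qed.

Lemma expf_pchar_sum (I : finType) (F : I -> L) :
  (\sum_i F i) ^+ q = \sum_i F i ^+ q.
Proof.
have q_gt0 : (0 < q)%N by case/andP: q_pchar.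
elim/big_rec2: _ => [|i y z _ <-]; first by rewrite expr0n eqn0Ngt q_gt0.
exact: exprDn_pchar.
Qed.

(** The [q]-th power sends each summand to the next, and the last one wraps around to [y], since
    [y ^+ (q ^ n) = y] in [L]. *)
Lemma relTrace_fixed (y : L) : relTrace q n y ^+ q = relTrace q n y.
Proof.
rewrite /relTrace expf_pchar_sum.
case: n card_L => [|n'] cL; first by rewrite !big_ord0.
rewrite big_ord_recr [RHS]big_ord_recl /= expn0 expr1 -exprM -expnSr -cL.
rewrite expf_card addrC; congr (_ + _); apply: eq_bigr => i _.
by rewrite -exprM -expnSr.
Qed.

(** With [N] the exponent, [N * q = N + (q ^ n - 1)], and [y ^+ (q ^ n - 1) = 1] for nonzero [y]. *)
Lemma norm_fixed (y : L) :
  (y ^+ ((q ^ n - 1) %/ (q - 1))) ^+ q = y ^+ ((q ^ n - 1) %/ (q - 1)).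
Proof.
have q_gt0 : (0 < q)%N by case/andP: q_pchar.
set N := (_ %/ _)%N.
have NE : (N * (q - 1) = q ^ n - 1)%N.
  by rewrite divnK // !subn1 predn_exp dvdn_mulr.
have [->|y_neq0] := eqVneq y 0.
  (* [0 ^+ N] is 1 or 0 according to whether [N] vanishes; both are fixed. *)
  by rewrite expr0n; case: (N == 0)%N; rewrite ?expr1n // expr0n eqn0Ngt q_gt0.
have yq : y ^+ (q ^ n - 1) = 1.
  apply: (mulfI y_neq0); rewrite -exprS subn1 prednK ?expn_gt0 ?q_gt0 //.
  by rewrite -card_L expf_card mulr1.
by rewrite -(subnKC q_gt0) exprD expr1 -exprM NE yq mulr1.
Qed.

(** F_q enters as the set of fixed points of [x ^+ q]; keeping [h] abstract treats trace and norm at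
    once. *)
Lemma cDelta_le1 (ell h f : L -> L) (c a b : L) :
    {morph ell : x y / x - y} ->
    (forall d x, d ^+ q = d -> ell (d * x) = d * ell x) ->
    (forall x, ell x ^+ q = ell (x ^+ q)) ->
    (forall x, h x ^+ q = h x) ->
    (forall x, f x = ell x + h (x ^+ q - x)) ->
  bijective f -> c ^+ q = c -> c != 1 -> (cDelta f c a b <= 1)%N.
Proof.
move=> ellB ellZ ellX hX fE f_bij c_fix c_neq1.
pose psi (x : L) := x ^+ q - x.
have frB (x y : L) : (x - y) ^+ q = x ^+ q - y ^+ q.
  by have := expf_pcharB 1 x y; rewrite expn1.
have psiB : {morph psi : x y / x - y}.
  by move=> x y; rewrite /psi frB !opprD addrACA.
have psiZ d x : d ^+ q = d -> psi (d * x) = d * psi x.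
  by move=> dq; rewrite /psi exprMn dq mulrBr.
have psi_f x : psi (f x) = ell (psi x).
  by rewrite /psi fE exprDn_pchar // ellX hX opprD addrACA subrr addr0 ellB.
have ell_inj : {in [set psi x | x : L] &, injective ell}.
  (* On a finite set, injectivity follows once the image has the same cardinality. Here [ell] maps
     the image of [psi] onto itself: [psi x] is hit by [psi (fV x)]. *)
  apply/imset_injP; apply/eqP; rewrite -imset_comp.
  rewrite (_ : (ell \o psi) @: L = psi @: L) //; have [fV _ fVK] := f_bij.
  apply/setP => z; apply/imsetP/imsetP => -[x _ ->].
    by exists (f x); rewrite ?psi_f.
  by exists (fV x); rewrite //= -psi_f fVK.
apply/card_le1_eqP => x y; rewrite !inE => /eqP xb /eqP yb.
have c1_neq0 : 1 - c != 0 by rewrite subr_eq0 eq_sym.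
have addD (u : L -> L) : {morph u : x y / x - y} -> {morph u : x y / x + y}.
  move=> uB z t; have uN : u (- t) = - u t.
    by rewrite -sub0r uB -[in u 0](subrr 0) uB subrr sub0r.
  by rewrite -{1}[t]opprK uB uN opprK.
have [ellD psiD] := (addD _ ellB, addD _ psiB).
(* As [c] is fixed by Frobenius, the difference becomes, under [psi], affine in [ell (psi z)] with
   nonzero slope [1 - c]. *)
have psiE z : psi (f (z + a) - c * f z) = (1 - c) * ell (psi z) + ell (psi a).
  by rewrite psiB psiZ // !psi_f psiD ellD mulrBl mul1r addrAC.
have psi_xy : psi x = psi y.
  apply: ell_inj; rewrite ?imset_f //; apply: (mulfI c1_neq0).
  by apply: (addIr (ell (psi a))); rewrite -!psiE xb yb.
have ell_xy : ell x = ell y.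
  (* Since [psi (x + a) = psi x + psi a], both [h] terms agree at [x] and [y]; what is left is
     [(1 - c) * ell x + ell a]. *)
  apply: (mulfI c1_neq0); apply: (addIr (ell a)).
  rewrite !mulrBl !mul1r ![_ - _ + _]addrAC -!ellD.
  move: xb; rewrite -yb !fE -!/(psi _) !psiD psi_xy !mulrDr !opprD.
  by rewrite !addrA ![_ + h _ - _]addrAC => /addIr/addIr.
by apply: (bij_inj f_bij); rewrite !fE -!/(psi _) ell_xy psi_xy.
Qed.

(** As [#|F| = q], the coefficients are fixed by Frobenius, so [ell] commutes with it; F_q-linearity
    comes from the exponents being powers of [q]. *)
Lemma PcN_linearized_add (F : finFieldType) (iota : {rmorphism F -> L})
    (card_F : #|F| = q) (k : nat) (a : 'I_k -> F) (h : L -> L) (g f : {poly L})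
    (b c : F) :
    (forall y, h y ^+ q = h y) ->
    (forall x, f.[x] =
       (iota b *: map_poly iota (linearized_poly q a)).[x] + h g.[x ^+ q - x]) ->
  permutation_poly f -> c != 1 -> PcN f (iota c).
Proof.
move=> hX fE f_bij c_neq1.
have iota_fix d : iota d ^+ q = iota d by rewrite -rmorphXn -card_F expf_card.
apply/bigmax_leqP => -[u v] _ /=.
pose ell x := (iota b *: map_poly iota (linearized_poly q a)).[x].
have ellE x : ell x = iota b * \sum_(i < k) iota (a i) * x ^+ (q ^ i).
  by rewrite /ell hornerZ linearized_poly_map_horner.
apply: (@cDelta_le1 ell (fun x => h g.[x])) => // [x y|d x d_fix|x|].
- rewrite !ellE -mulrBr -sumrB; congr (_ * _).
  by apply: eq_bigr => i _; rewrite expf_pcharB mulrBr.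
- rewrite !ellE [RHS]mulrCA; congr (_ * _).
  rewrite mulr_sumr; apply: eq_bigr => i _.
  rewrite exprMn mulrCA; congr (_ * _).
  by elim: (i : nat) => // j IH; rewrite expnS exprM d_fix.
- rewrite !ellE exprMn iota_fix expf_pchar_sum; congr (_ * _).
  by apply: eq_bigr => i _; rewrite exprMn iota_fix exprAC.
- by rewrite -(inj_eq (fmorph_inj iota)) rmorph1 in c_neq1.
Qed.

End FrobeniusFixed.

Theorem theorem3p5 (p m q n : nat) (F L : finFieldType)
    (iota : {rmorphism F -> L})
    (p_prime : prime p) (m_gt0 : (0 < m)%N) (n_gt0 : (0 < n)%N)
    (q_def : q = (p ^ m)%N)
    (card_F : #|F| = q) (card_L : #|L| = (q ^ n)%N)
    (k : nat) (a : 'I_k -> F) (g : {poly L}) (b : F) (b_neq0 : b != 0) :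
  (permutation_poly (f1 iota q n (linearized_poly q a) g b) ->
   forall c : F, c != 1 -> PcN (f1 iota q n (linearized_poly q a) g b) (iota c))
  /\
  (permutation_poly (f2 iota q n (linearized_poly q a) g b) ->
   forall c : F, c != 1 -> PcN (f2 iota q n (linearized_poly q a) g b) (iota c)).
Proof.
have p_pchar : p \in [pchar L].
  by apply: (@card_finPcharP _ p (m * n)); rewrite // card_L q_def expnM.
(* This is the form in which additivity of [x ^+ q] on [L] is used. *)
have q_pchar : [pchar L].-nat q.
  by rewrite (eq_pnat _ (pcharf_eq p_pchar)) q_def pnatX pnat_id.
split=> f_perm c c_neq1.
- apply: (@PcN_linearized_add _ _ q_pchar _ _ card_F _ _ _ _ _ _ _
    (@relTrace_fixed _ _ _ q_pchar card_L) _ f_perm c_neq1) => x.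
  rewrite /f1 hornerD; congr (_ + _); rewrite /relTrace horner_sum.
  by apply: eq_bigr => i _; rewrite horner_exp horner_comp !hornerE.
- apply: (@PcN_linearized_add _ _ q_pchar _ _ card_F _ _ _ _ _ _ _
    (@norm_fixed _ _ _ q_pchar card_L) _ f_perm c_neq1) => x.
  by rewrite /f2 hornerD horner_exp horner_comp !hornerE.
Qed.
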